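(* Let $O=(0,0)$, $A=(1,0)$, and let $P=(x,y)$, with $0<x<1$, be a point of the planar interception curve (defined in the context). Let $Q$ be the point where the line $OP$ meets the line $X=1$, and let the tangent line of the curve at $P$ meet the $y$-axis at $U$ and the line $X=1$ at $T$. Then the radius of the circle through $O$ and tangent to the line $UT$ at the point $P$ is equal to the radius of the circle through $O$ and tangent to the line $AT$ (that is, the line $X=1$) at the point $Q$.
   Context: The planar interception curve is the graph of the function $y=y(x)$, $0\le x<1$, starting at the origin, such that the arc length of the curve from $O$ to $P=(x,y(x))$ equals the length $y/x$ of the segment $AQ$ for $0<x<1$, where $A=(1,0)$ and $Q=(1,y/x)$ is the point of the line $X=1$ on the ray $OP$: $\int_0^x\sqrt{1+(y'(t))^2}\,dt=y/x$. Equivalently, it satisfies the differential equation $x^2\sqrt{1+(y'(x))^2}=x\,y'(x)-y(x)$ with $y(0)=0$, and is parametrized by the slope $p=y'(x)\ge 0$ as $$x(p)=\frac{1}{\sqrt[4]{p^2+1}}\int_0^p\frac{dt}{2\sqrt[4]{t^2+1}},\qquad y(p)=p\,x(p)-(x(p))^2\sqrt{p^2+1}\quad(p\ge 0).$$ *)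

(* Defs.v *)
From Stdlib Require Import Reals.
From Coquelicot Require Import Coquelicot.
Open Scope R_scope.

(* Only the values of [y] on [0,1) matter: [Derive y 0] may depend on values of
   [y] to the left of 0, but the integral ignores the integrand at an endpoint.
   The arc length condition makes the right derivative of [y] at 0
   exist and vanish: the integral, hence [y x / x], tends to 0 with [x]. *)
Definition interception_curve (y : R -> R) : Prop :=
  y 0 = 0 /\
  forall x : R, 0 < x < 1 ->
    ex_derive y x /\
    is_RInt (fun t : R => sqrt (1 + (Derive y t) ^ 2)) 0 x (y x / x).

Definition point : Type := (R * R)%type.

Definition dist_pt (X Y : point) : R := dist_euc (fst X) (snd X) (fst Y) (snd Y).

Definition line : Type := point -> Prop.

(* A line only when [X <> Y]. *)
Definition line_through (X Y : point) : line :=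
  fun Z => (fst Y - fst X) * (snd Z - snd X) = (snd Y - snd X) * (fst Z - fst X).

Definition vertical_line (a : R) : line := fun Z => fst Z = a.

Definition tangent_line (y : R -> R) (x : R) : line :=
  fun Z => snd Z = y x + Derive y x * (fst Z - x).

Record circle : Type := Circle { center : point; radius : R }.

Definition on_circle (c : circle) (Z : point) : Prop :=
  dist_pt (center c) Z = radius c.

Definition tangent_at (c : circle) (l : line) (X : point) : Prop :=
  forall Z : point, (l Z /\ on_circle c Z) <-> Z = X.

Definition circle_through_tangent (Y : point) (l : line) (X : point)
    (c : circle) : Prop :=
  0 < radius c /\ on_circle c Y /\ tangent_at c l X.

(* Main.v *)
Require Import Defs.
From Stdlib Require Import Reals Lra ClassicalEpsilon.
From Coquelicot Require Import Coquelicot.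
Open Scope R_scope.

(** The curve is governed by x^2 sqrt(1 + p^2) = x p - y with p = y'(x), and this
    equation makes both radii computable.

    Geometry.  A circle tangent at X to a line l and passing through a point Y
    off l is unique, and its radius is |XY|^2 / (2 dist(Y, l)): the centre is
    X + m n with n normal to l, and the distance to Y fixes m
    ([circle_through_tangent_radius]).  The distance from O to the tangent line
    is (x p - y) / sqrt(1 + p^2), which the equation turns into x^2, so the first
    radius is OP^2 / (2 x^2).  The distance from O to the line X = 1 is 1, so the
    second radius is OQ^2 / 2, and OQ = OP / x by homothety.

    Analysis.  The curve is only given by an arc length identity: with
    F(x) = y(x)/x, the increments of F are integrals of v = sqrt(1 + y'^2).  As y'
    need not be continuous a priori, this yields F' = v only almost everywhere,
    whereas the equation is F' = v at every point ([interception_curve_ode]).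
    The tool is the comparison [RInt_le_increment], which holds for any Riemann
    integrable integrand: if f <= G' pointwise then the integral of f is at most
    the increment of G.  Localized at a point, it says that F' <= G' there if
    v <= G' nearby ([derive_le_of_integrand_le]).

    - v <= F': by Cauchy-Schwarz v(s) >= (1 + p y'(s)) / v(t) for p = y'(t), and the
      right-hand side is the derivative of a combination of s and y(s).  In other
      words, an arc is at least as long as its projection on the tangent at t.
    - F' <= v: since y' = t F' + F, the speed is a function of F' whose slope is
      at most t < 1.  If F'(t) > d := v(t), then this contraction property, along
      with v <= F', gives v <= beta F' + (1 - beta) d near t for some beta < 1,
      whence F'(t) <= beta F'(t) + (1 - beta) d, that is, F'(t) <= d. *)

(** * Comparing a Riemann integral with an increment *)

(** The hypothesis on [tag] is what the mean value theorem provides; the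
    increments of [G] then telescope along the subdivision. *)
Lemma Riemann_sum_le_increment (f G : R -> R) (tag : R -> R -> R) (a b : R)
    (Htag : forall u v, a <= u -> u <= v -> v <= b ->
       f (tag u v) * (v - u) <= G v - G u)
    (P : list R) (u : R) :
  a <= u -> sorted Rle (u :: P)%list -> seq.last u P <= b ->
  Riemann_sum f (SF_seq_f2 tag (u :: P)%list) <= G (seq.last u P) - G u.
Proof.
revert u; induction P as [|v P IH]; intros u Hau Hs Hb.
- cbn; unfold zero; cbn; lra.
- rewrite SF_cons_f2 by (simpl; auto with arith).
  rewrite Riemann_sum_cons.
  destruct Hs as [Huv Hs].
  assert (Hvb : v <= b).
  { apply Rle_trans with (2 := Hb).
    exact (sorted_last (v :: P)%list 0 Hs (PeanoNat.Nat.lt_0_succ _) v). }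
  assert (H1 := Htag u v Hau Huv Hvb).
  assert (H2 := IH v (Rle_trans _ _ _ Hau Huv) Hs Hb).
  change (seq.last u (v :: P)%list) with (seq.last v P).
  change ((v - u) * f (tag u v) + Riemann_sum f (SF_seq_f2 tag (v :: P)%list)
    <= G (seq.last v P) - G u).
  lra.
Qed.

(** The fundamental theorem of calculus does not apply, since [g] need not be
    integrable.  Instead the tags of fine subdivisions are chosen by the mean
    value theorem, so that the corresponding Riemann sums of [f] are at most the
    increment of [G]. *)
Lemma RInt_le_increment (f G g : R -> R) (a b I : R) :
  a < b -> is_RInt f a b I ->
  (forall t, a <= t <= b -> is_derive G t (g t) /\ f t <= g t) ->
  I <= G b - G a.
Proof.
intros Hab HI HG.
(* Tags of subdivisions are given by a total function of the endpoints of the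
   cells, hence the extension to cells outside [a, b], where any tag will do. *)
assert (Hex : forall u v, exists c, (u <= v -> u <= c <= v) /\
  (a <= u -> u <= v -> v <= b -> f c * (v - u) <= G v - G u)).
{ intros u v.
  destruct (Rle_dec a u) as [Hau|Hau]; [|exists u; split; lra].
  destruct (Rle_dec v b) as [Hvb|Hvb]; [|exists u; split; lra].
  destruct (Rle_dec u v) as [Huv|Huv]; [|exists u; split; lra].
  destruct (MVT_gen G u v g) as [c [Hc Heq]];
    rewrite ?(Rmin_left u v), ?(Rmax_right u v) in * by lra.
  - intros t Ht; apply HG; lra.
  - intros t Ht; apply continuity_pt_filterlim.
    apply (ex_derive_continuous G); exists (g t); apply HG; lra.
  - exists c; split; [lra|intros _ _ _].
    rewrite Heq; apply Rmult_le_compat_r; [lra|apply HG; lra]. }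
set (tag := fun u v => proj1_sig (constructive_indefinite_description _ (Hex u v))).
assert (Htag : forall u v, (u <= v -> u <= tag u v <= v) /\
  (a <= u -> u <= v -> v <= b -> f (tag u v) * (v - u) <= G v - G u)).
{ intros u v; unfold tag; destruct constructive_indefinite_description; assumption. }
clearbody tag.
apply Rnot_lt_le; intros Hlt.
assert (He : 0 < I - (G b - G a)) by lra.
destruct (HI (fun z => G b - G a < z)) as [d Hd].
{ exists (mkposreal _ He); intros z Hz.
  apply Rabs_lt_between in Hz; simpl in Hz.
  unfold minus, plus, opp in Hz; simpl in Hz; lra. }
destruct (seq_step_unif_part_ex a b d) as [n Hn].
destruct (Riemann_fine_unif_part tag a b n) as [_ [Hp [Hh Hl]]].
{ intros u v Huv; apply Htag, Huv. }
{ lra. }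
specialize (Hd (SF_seq_f2 tag (unif_part a b n))).
assert (Hsum := Riemann_sum_le_increment f G tag a b
   (fun u v => proj2 (Htag u v)) (seq.behead (unif_part a b n)) a (Rle_refl a)).
assert (Hcons : (a :: seq.behead (unif_part a b n))%list = unif_part a b n).
{ rewrite <- (head_unif_part 0 a b n) at 1; reflexivity. }
assert (Hlast : seq.last a (seq.behead (unif_part a b n)) = b).
{ rewrite <- (last_unif_part 0 a b n) at 2. rewrite <- Hcons at 2; reflexivity. }
rewrite Hcons, Hlast in Hsum.
assert (Hsum' := Hsum (unif_part_sort a b n (Rlt_le _ _ Hab)) (Rle_refl b)).
assert (Hgt : G b - G a < scal (sign (b - a))
   (Riemann_sum f (SF_seq_f2 tag (unif_part a b n)))).
{ apply Hd.
  - rewrite SF_lx_f2 by (simpl; auto with arith). exact Hn.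
  - rewrite Rmin_left, Rmax_right by lra; auto. }
rewrite sign_eq_1 in Hgt by lra.
change (scal 1 ?s) with (1 * s) in Hgt; lra.
Qed.

(** The comparison bounds increments, hence difference quotients, of [F] by those
    of [G]; it reaches the derivative of [F] at the very point [x0], where [f]
    is not assumed continuous. *)
Lemma derive_le_of_integrand_le (f F G g : R -> R) (x0 b0 l : R) :
  x0 < b0 ->
  (forall b, x0 < b < b0 -> is_RInt f x0 b (F b - F x0)) ->
  is_derive F x0 l ->
  (forall t, x0 <= t < b0 -> is_derive G t (g t) /\ f t <= g t) ->
  l <= g x0.
Proof.
intros Hb0 HI HF HG.
apply Rnot_lt_le; intros Hlt.
assert (HFG : is_derive (fun t => F t - G t) x0 (l - g x0)).
{ apply (is_derive_minus F G x0 l (g x0)); [exact HF|apply HG; lra]. }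
apply is_derive_Reals in HFG.
destruct (HFG (l - g x0)) as [d Hd]; [lra|].
set (h := Rmin (d / 2) ((b0 - x0) / 2)).
assert (Hh : 0 < h < d /\ h < b0 - x0).
{ unfold h; destruct d as [d Hd0]; simpl.
  unfold Rmin; destruct Rle_dec; lra. }
specialize (Hd h); rewrite Rabs_pos_eq with (x := h) in Hd by lra.
specialize (Hd ltac:(lra) ltac:(lra)).
apply Rabs_lt_between in Hd.
assert (Hle : F (x0 + h) - F x0 <= G (x0 + h) - G x0).
{ apply RInt_le_increment with f g; [lra|apply HI; lra|].
  intros t Ht; apply HG; lra. }
assert (Hq : (F (x0 + h) - G (x0 + h) - (F x0 - G x0)) / h <= 0).
{ apply Rle_div_l; lra. }
lra.
Qed.

(** * The differential equation of the curve *)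

(** The function u |-> sqrt(1 + u^2) is 1-Lipschitz. *)
Lemma sqrt_1_plus_sqr_shift (u v : R) : 0 <= v ->
  sqrt (1 + (u + v) ^ 2) <= sqrt (1 + u ^ 2) + v.
Proof.
intros Hv.
assert (Hu := pow2_ge_0 u).
assert (Hs := sqrt_pos (1 + u ^ 2)).
assert (Hs2 := pow2_sqrt (1 + u ^ 2) ltac:(lra)).
rewrite <- (sqrt_pow2 (sqrt (1 + u ^ 2) + v)) by lra.
apply sqrt_le_1_alt.
assert (u <= sqrt (1 + u ^ 2)) by (apply Rnot_lt_le; intros H; nra).
nra.
Qed.

(** Cauchy-Schwarz for the vectors (1, p) and (1, q). *)
Lemma one_plus_mult_le_sqrt (p q : R) :
  1 + p * q <= sqrt (1 + p ^ 2) * sqrt (1 + q ^ 2).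
Proof.
assert (Hp := pow2_ge_0 p); assert (Hq := pow2_ge_0 q).
rewrite <- sqrt_mult by lra.
apply Rle_trans with (1 := Rle_abs _).
rewrite <- sqrt_Rsqr_abs; apply sqrt_le_1_alt.
rewrite Rsqr_pow2; assert (H := pow2_ge_0 (p - q)); nra.
Qed.

Definition speed (y : R -> R) (t : R) : R := sqrt (1 + Derive y t ^ 2).

(** The slope of the ray from the origin, which is also the length AQ. *)
Definition ray_slope (y : R -> R) (t : R) : R := y t / t.

Lemma speed_ge_1 (y : R -> R) (t : R) : 1 <= speed y t.
Proof.
unfold speed; rewrite <- sqrt_1 at 1.
apply sqrt_le_1_alt; assert (H := pow2_ge_0 (Derive y t)); lra.
Qed.

Lemma is_derive_ray_slope (y : R -> R) (t : R) :
  t <> 0 -> ex_derive y t ->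
  is_derive (ray_slope y) t ((t * Derive y t - y t) / t ^ 2).
Proof.
intros Ht Hy; unfold ray_slope.
assert (H := is_derive_div y (fun s => s) t _ 1 (Derive_correct y t Hy)
  (is_derive_id t) Ht).
replace ((t * Derive y t - y t) / t ^ 2)
  with ((Derive y t * t - y t * 1) / t ^ 2) by (field; exact Ht).
exact H.
Qed.

Lemma ex_derive_ray_slope (y : R -> R) (t : R) :
  t <> 0 -> ex_derive y t -> ex_derive (ray_slope y) t.
Proof.
intros Ht Hy; eexists; apply is_derive_ray_slope; assumption.
Qed.

Lemma Derive_eq_ray_slope (y : R -> R) (t : R) :
  t <> 0 -> ex_derive y t ->
  Derive y t = t * Derive (ray_slope y) t + ray_slope y t.
Proof.
intros Ht Hy.
rewrite (is_derive_unique _ _ _ (is_derive_ray_slope y t Ht Hy)).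
unfold ray_slope; field; exact Ht.
Qed.

Lemma interception_ex_derive (y : R -> R) (t : R) :
  interception_curve y -> 0 < t < 1 -> ex_derive y t.
Proof. intros hy Ht; apply hy, Ht. Qed.

Lemma interception_is_RInt_speed (y : R -> R) (a b : R) :
  interception_curve y -> 0 < a -> a < b < 1 ->
  is_RInt (speed y) a b (ray_slope y b - ray_slope y a).
Proof.
intros hy Ha Hb.
destruct (proj2 hy a ltac:(lra)) as [_ HIa].
destruct (proj2 hy b ltac:(lra)) as [_ HIb].
assert (H := is_RInt_Chasles _ _ _ _ _ _ (is_RInt_swap _ _ _ _ HIa) HIb).
replace (ray_slope y b - ray_slope y a) with (plus (opp (y a / a)) (y b / b))
  by (unfold plus, opp, ray_slope; cbn; ring).
exact H.
Qed.

Lemma interception_ray_slope_pos (y : R -> R) (t : R) :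
  interception_curve y -> 0 < t < 1 -> 0 < ray_slope y t.
Proof.
intros hy Ht.
destruct (proj2 hy t Ht) as [_ HI].
assert (H1 := is_RInt_const 0 t 1).
change (scal (t - 0) 1) with ((t - 0) * 1) in H1.
assert (H := is_RInt_le _ _ 0 t _ _ ltac:(lra) H1 HI
  (fun s _ => speed_ge_1 y s)).
unfold ray_slope; lra.
Qed.

(** An arc is at least as long as its orthogonal projection on the tangent at
    its starting point; dividing by the increment of the abscissa gives the
    inequality in the limit. *)
Lemma interception_speed_le (y : R -> R) (t : R) :
  interception_curve y -> 0 < t < 1 -> speed y t <= Derive (ray_slope y) t.
Proof.
intros hy Ht.
set (p := Derive y t).
assert (Hf := speed_ge_1 y t).
(* (s + p y(s)) / v(t) is the abscissa of the projection of (s, y(s)) on the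
   tangent direction at t.  The comparison lemma bounds integrals from above, so
   it is applied to the opposites. *)
assert (H : - Derive (ray_slope y) t <= - ((1 + p * p) / speed y t)).
{ apply (derive_le_of_integrand_le
    (fun s => - speed y s) (fun s => - ray_slope y s)
    (fun s => - ((s + p * y s) / speed y t))
    (fun s => - ((1 + p * Derive y s) / speed y t)) t 1); [lra| | |].
  - intros b Hb.
    replace (- ray_slope y b - - ray_slope y t)
      with (opp (ray_slope y b - ray_slope y t)) by (unfold opp; cbn; ring).
    apply (is_RInt_opp (speed y)), interception_is_RInt_speed; try assumption; lra.
  - apply (is_derive_opp (ray_slope y)), Derive_correct, ex_derive_ray_slope;
      [lra|apply interception_ex_derive; assumption].
  - intros s Hs; split.
    + assert (Hy : ex_derive y s) by (apply interception_ex_derive; [exact hy|lra]).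
      auto_derive; [exact Hy|].
      change (Derive (fun z => y z) s) with (Derive y s); field; lra.
    + apply Ropp_le_contravar, Rle_div_l; [lra|].
      unfold speed; rewrite Rmult_comm; apply one_plus_mult_le_sqrt. }
assert (Hf2 : (1 + p * p) / speed y t = speed y t).
{ replace (1 + p * p) with (speed y t ^ 2); [field; lra|].
  unfold speed; fold p; rewrite pow2_sqrt; [ring|].
  assert (Hp := pow2_ge_0 p); lra. }
lra.
Qed.

(** The speed at abscissa [s] is v(s) = sqrt(1 + (s F'(s) + F(s))^2), a function of
    F'(s) that is Lipschitz with constant s < 1.  If F'(t) exceeded d := v(t), then
    S(s) := sqrt(1 + (s d + F(s))^2), the value of this function at d, would be
    below d for s = t, and by continuity for s near t.  There v <= d + s (F' - d)
    when F' >= d, and v <= F' otherwise; both bounds are at most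
    beta F' + (1 - beta) d when s <= beta < 1. *)
Lemma interception_speed_ge (y : R -> R) (t : R) :
  interception_curve y -> 0 < t < 1 -> Derive (ray_slope y) t <= speed y t.
Proof.
intros hy Ht.
apply Rnot_lt_le; intros Hlt.
assert (Hexy : forall s, 0 < s < 1 -> ex_derive y s).
{ intros s Hs; apply interception_ex_derive; assumption. }
assert (Hex : forall s, 0 < s < 1 -> ex_derive (ray_slope y) s).
{ intros s Hs; apply ex_derive_ray_slope; [lra|auto]. }
assert (HDe : forall s, 0 < s < 1 ->
  Derive y s = s * Derive (ray_slope y) s + ray_slope y s).
{ intros s Hs; apply Derive_eq_ray_slope; [lra|auto]. }
assert (Hle := fun s => interception_speed_le y s hy).
assert (HF := interception_ray_slope_pos y t hy Ht).
set (d := speed y t) in *.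
assert (Hd : 1 <= d) by apply speed_ge_1.
revert Hex HDe Hle HF Hlt.
set (F := ray_slope y); intros Hex HDe Hle HF Hlt.
set (S := fun s => sqrt (1 + (s * d + F s) ^ 2)).
assert (HSt : S t < d).
{ unfold d at 1, S, speed; rewrite (HDe t Ht).
  assert (Hu : 0 < t * d) by (apply Rmult_lt_0_compat; lra).
  assert (Hv : t * d < t * Derive F t) by (apply Rmult_lt_compat_l; lra).
  apply sqrt_lt_1_alt; nra. }
assert (HScont : continuous S t).
{ apply (continuous_comp (fun s => 1 + (s * d + F s) ^ 2) sqrt).
  - apply (ex_derive_continuous (fun s => 1 + (s * d + F s) ^ 2)).
    assert (H := Hex t Ht); auto_derive; auto.
  - apply continuous_sqrt. }
destruct (HScont (fun z => z < d)) as [e He].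
{ apply open_lt; exact HSt. }
set (beta := (1 + t) / 2).
assert (Hbeta : t < beta < 1) by (unfold beta; lra).
assert (H : Derive F t <= beta * Derive F t + (1 - beta) * d); [|nra].
apply (derive_le_of_integrand_le (speed y) F
    (fun s => beta * F s + (1 - beta) * d * s)
    (fun s => beta * Derive F s + (1 - beta) * d) t (Rmin beta (t + e))).
- apply Rmin_glb_lt; [lra|destruct e; simpl; lra].
- intros b Hb; assert (H := Rmin_l beta (t + e)).
  apply interception_is_RInt_speed; try assumption; lra.
- apply Derive_correct, Hex, Ht.
- intros s Hs.
  assert (H1 := Rmin_l beta (t + e)); assert (H2 := Rmin_r beta (t + e)).
  assert (Hs1 : 0 < s < 1) by lra.
  split.
  + auto_derive; [exact (Hex s Hs1)|].
    change (Derive (fun z => F z) s) with (Derive F s); ring.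
  + destruct (Rle_lt_dec d (Derive F s)) as [Hds|Hds].
    * assert (HSs : S s < d).
      { apply He; apply Rabs_lt_between.
        unfold minus, plus, opp; cbn; lra. }
      assert (Hv : 0 <= s * (Derive F s - d)) by (apply Rmult_le_pos; lra).
      assert (Hsh := sqrt_1_plus_sqr_shift (s * d + F s) _ Hv).
      replace (s * d + F s + s * (Derive F s - d)) with (Derive y s) in Hsh
        by (rewrite (HDe s Hs1); ring).
      fold (S s) in Hsh; fold (speed y s) in Hsh.
      assert (s * (Derive F s - d) <= beta * (Derive F s - d))
        by (apply Rmult_le_compat_r; lra).
      lra.
    * assert (H3 := Hle s Hs1).
      assert (0 <= (1 - beta) * (d - Derive F s)) by (apply Rmult_le_pos; lra).
      lra.
Qed.

Lemma interception_curve_ode (y : R -> R) (t : R) :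
  interception_curve y -> 0 < t < 1 ->
  t ^ 2 * sqrt (1 + Derive y t ^ 2) = t * Derive y t - y t.
Proof.
intros hy Ht.
assert (Hy := interception_ex_derive y t hy Ht).
assert (H : speed y t = Derive (ray_slope y) t).
{ apply Rle_antisym;
    [apply interception_speed_le|apply interception_speed_ge]; assumption. }
rewrite (is_derive_unique _ _ _ (is_derive_ray_slope y t ltac:(lra) Hy)) in H.
unfold speed in H; rewrite H; field; lra.
Qed.

(** * Circles tangent to a line *)

Lemma dist_pt_sqr (X Y : point) :
  dist_pt X Y ^ 2 = (fst X - fst Y) ^ 2 + (snd X - snd Y) ^ 2.
Proof.
unfold dist_pt, dist_euc; rewrite pow2_sqrt; [unfold Rsqr; ring|].
apply Rplus_le_le_0_compat; apply Rle_0_sqr.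
Qed.

Lemma sum_sqr_le_0 (u v : R) : u ^ 2 + v ^ 2 <= 0 -> u = 0 /\ v = 0.
Proof.
intros H; assert (Hu := pow2_ge_0 u); assert (Hv := pow2_ge_0 v).
split; apply Rsqr_0_uniq; rewrite Rsqr_pow2; lra.
Qed.

Lemma on_circle_sqr (c : circle) (Z : point) :
  0 < radius c ->
  (on_circle c Z <->
   (fst (center c) - fst Z) ^ 2 + (snd (center c) - snd Z) ^ 2 = radius c ^ 2).
Proof.
intros Hr; unfold on_circle, dist_pt, dist_euc.
rewrite <- !Rsqr_pow2.
set (s := _ + _).
assert (Hs : 0 <= s) by (unfold s; apply Rplus_le_le_0_compat; apply Rle_0_sqr).
split; intros H.
- rewrite <- H, Rsqr_sqrt; auto.
- rewrite H; apply sqrt_Rsqr; lra.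
Qed.

(** If the centre does not lie on the perpendicular at [X], then the line meets
    the circle again at the reflection of [X] in the foot of the perpendicular
    from the centre. *)
Lemma tangent_at_perp (c : circle) (V W X : point) :
  0 < radius c -> V <> W -> line_through V W X ->
  (tangent_at c (line_through V W) X <->
   on_circle c X /\
   (fst (center c) - fst X) * (fst W - fst V) +
   (snd (center c) - snd X) * (snd W - snd V) = 0).
Proof.
intros Hr HVW HX.
assert (Hd : 0 < (fst W - fst V) ^ 2 + (snd W - snd V) ^ 2).
{ apply Rnot_le_lt; intros H; apply HVW.
  apply sum_sqr_le_0 in H; apply injective_projections; lra. }
unfold tangent_at, line_through in *.
revert Hd HX.
set (d1 := fst W - fst V); set (d2 := snd W - snd V); intros Hd HX.
set (e1 := fst (center c) - fst X); set (e2 := snd (center c) - snd X).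
split.
- intros HT.
  assert (HcX : on_circle c X) by (apply (HT X); reflexivity).
  split; [exact HcX|].
  set (k := e1 * d1 + e2 * d2).
  (* X + t d is the reflection of X in the foot of the perpendicular. *)
  set (t := 2 * k / (d1 ^ 2 + d2 ^ 2)).
  assert (Ht : t * (d1 ^ 2 + d2 ^ 2) = 2 * k) by (unfold t; field; lra).
  assert (HZ : (fst X + t * d1, snd X + t * d2) = X).
  { apply HT; simpl; split; [nra|].
    apply (on_circle_sqr c _ Hr) in HcX; apply (on_circle_sqr c _ Hr); cbn [fst snd].
    fold e1 e2 in HcX; rewrite <- HcX.
    replace (fst (center c) - (fst X + t * d1)) with (e1 - t * d1) by (unfold e1; ring).
    replace (snd (center c) - (snd X + t * d2)) with (e2 - t * d2) by (unfold e2; ring).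
    transitivity (e1 ^ 2 + e2 ^ 2 + t * (t * (d1 ^ 2 + d2 ^ 2) - 2 * k)).
    + unfold k; ring.
    + rewrite Ht; ring. }
  assert (Z1 : t * d1 = 0) by (apply (f_equal fst) in HZ; simpl in HZ; lra).
  assert (Z2 : t * d2 = 0) by (apply (f_equal snd) in HZ; simpl in HZ; lra).
  assert (Hk : 2 * k = t * d1 * d1 + t * d2 * d2) by (rewrite <- Ht; ring).
  rewrite Z1, Z2 in Hk; fold k; lra.
- intros [HcX Hperp] Z; split; [|intros ->; auto].
  intros [HZ HcZ].
  apply (on_circle_sqr c _ Hr) in HcX, HcZ.
  set (f1 := fst Z - fst X); set (f2 := snd Z - snd X).
  assert (Hpar : d1 * f2 = d2 * f1) by (unfold f1, f2; nra).
  assert (Hpyth : f1 ^ 2 + f2 ^ 2 = 2 * (e1 * f1 + e2 * f2)).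
  { unfold e1, e2, f1, f2; nra. }
  (* Lagrange's identity: both e . d and d x f vanish. *)
  assert (H0 : (d1 ^ 2 + d2 ^ 2) * (e1 * f1 + e2 * f2) = 0).
  { transitivity ((e1 * d1 + e2 * d2) * (d1 * f1 + d2 * f2)
      + (e2 * d1 - e1 * d2) * (d1 * f2 - d2 * f1)); [ring|].
    rewrite Hperp, Hpar; ring. }
  apply Rmult_integral in H0; destruct H0 as [H0|H0]; [lra|].
  rewrite H0 in Hpyth.
  destruct (sum_sqr_le_0 f1 f2) as [E1 E2]; [lra|].
  unfold f1, f2 in *; apply injective_projections; lra.
Qed.

(** As [n] is |VW| times the signed distance from [Y] to the line, the radius is
    |XY|^2 / (2 dist(Y, line)).  The centre is [X] + m (- d2, d1), with d the
    direction of the line; passing through [Y] means |XY|^2 = 2 m n. *)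
Lemma circle_through_tangent_radius (V W X Y : point) :
  let n := (fst W - fst V) * (snd Y - snd V) - (snd W - snd V) * (fst Y - fst V) in
  line_through V W X -> n <> 0 ->
  exists c, unique (circle_through_tangent Y (line_through V W) X) c /\
    radius c = dist_pt X Y ^ 2 * dist_pt V W / (2 * Rabs n).
Proof.
intros n HX Hn.
assert (HVW : V <> W) by (intros ->; apply Hn; unfold n; ring).
set (d1 := fst W - fst V) in *; set (d2 := snd W - snd V) in *.
set (g1 := fst Y - fst X); set (g2 := snd Y - snd X).
assert (Hn' : n = d1 * g2 - d2 * g1).
{ unfold line_through in HX; fold d1 d2 in HX; unfold n, g1, g2; nra. }
assert (Hd : 0 < d1 ^ 2 + d2 ^ 2).
{ apply Rnot_le_lt; intros H; apply Hn.
  apply sum_sqr_le_0 in H; destruct H as [E1 E2]; unfold n; rewrite E1, E2; ring. }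
assert (Hg : 0 < g1 ^ 2 + g2 ^ 2).
{ apply Rnot_le_lt; intros H; apply Hn.
  apply sum_sqr_le_0 in H; destruct H as [E1 E2]; rewrite Hn', E1, E2; ring. }
set (m := (g1 ^ 2 + g2 ^ 2) / (2 * n)).
assert (Hm : 2 * m * n = g1 ^ 2 + g2 ^ 2) by (unfold m; field; exact Hn).
assert (HXY : dist_pt X Y ^ 2 = g1 ^ 2 + g2 ^ 2).
{ rewrite dist_pt_sqr; unfold g1, g2; ring. }
assert (HVWd : dist_pt V W = sqrt (d1 ^ 2 + d2 ^ 2)).
{ unfold dist_pt, dist_euc; f_equal; unfold Rsqr, d1, d2; ring. }
set (r := dist_pt X Y ^ 2 * dist_pt V W / (2 * Rabs n)).
assert (Habs : 0 < Rabs n) by (apply Rabs_pos_lt; exact Hn).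
assert (Hr : 0 < r).
{ unfold r; rewrite HXY, HVWd; apply Rdiv_lt_0_compat; [|lra].
  apply Rmult_lt_0_compat; [exact Hg|apply sqrt_lt_R0; exact Hd]. }
assert (Hr2 : r ^ 2 = m ^ 2 * (d1 ^ 2 + d2 ^ 2)).
{ unfold r; rewrite HXY, HVWd.
  transitivity ((g1 ^ 2 + g2 ^ 2) ^ 2 * (sqrt (d1 ^ 2 + d2 ^ 2)) ^ 2 / (4 * Rabs n ^ 2)).
  - field; lra.
  - rewrite pow2_sqrt, pow2_abs by lra; unfold m; field; exact Hn. }
exists (Circle (fst X - m * d2, snd X + m * d1) r); split; [split|reflexivity].
- split; [exact Hr|split].
  + apply on_circle_sqr; [exact Hr|cbn [fst snd center radius]].
    rewrite Hr2.
    replace (fst X - m * d2 - fst Y) with (- (m * d2 + g1)) by (unfold g1; ring).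
    replace (snd X + m * d1 - snd Y) with (m * d1 - g2) by (unfold g2; ring).
    transitivity (m ^ 2 * (d1 ^ 2 + d2 ^ 2) + (g1 ^ 2 + g2 ^ 2 - 2 * m * n)).
    * rewrite Hn'; ring.
    * rewrite Hm; ring.
  + apply tangent_at_perp; [exact Hr|exact HVW|exact HX|split].
    * apply on_circle_sqr; [exact Hr|cbn [fst snd center radius]]. rewrite Hr2; ring.
    * simpl; fold d1 d2; ring.
- intros [[c1 c2] r'] [Hr' [HY HT]]; simpl in Hr'.
  apply tangent_at_perp in HT; auto; destruct HT as [HcX Hperp].
  apply (on_circle_sqr (Circle (c1, c2) r') Y Hr') in HY.
  apply (on_circle_sqr (Circle (c1, c2) r') X Hr') in HcX.
  cbn [fst snd center radius] in *.
  set (e1 := c1 - fst X) in *; set (e2 := c2 - snd X) in *.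
  fold d1 d2 in Hperp.
  assert (Heg : 2 * (e1 * g1 + e2 * g2) = g1 ^ 2 + g2 ^ 2).
  { unfold e1, e2, g1, g2 in *; nra. }
  assert (E1 : e1 = - m * d2).
  { apply Rmult_eq_reg_r with (2 * n); [|lra].
    transitivity (- (2 * m * n) * d2); [rewrite Hm, <- Heg, Hn'|ring].
    transitivity (-2 * (e1 * g1 * d2 + g2 * (e2 * d2))
      + 2 * g2 * (e1 * d1 + e2 * d2)); [ring|rewrite Hperp; ring]. }
  assert (E2 : e2 = m * d1).
  { apply Rmult_eq_reg_r with (2 * n); [|lra].
    transitivity ((2 * m * n) * d1); [rewrite Hm, <- Heg, Hn'|ring].
    transitivity (2 * (g2 * e2 * d1 + g1 * (e1 * d1))
      - 2 * g1 * (e1 * d1 + e2 * d2)); [ring|rewrite Hperp; ring]. }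
  assert (Er : r = r').
  { apply Rsqr_inj; [lra|lra|]. rewrite !Rsqr_pow2, <- HcX, E1, E2, Hr2; ring. }
  unfold e1, e2 in *.
  f_equal; [f_equal; lra|exact Er].
Qed.

(** * Equality of the two radii *)

Theorem theorem2 (y : R -> R) (hy : interception_curve y)
    (x : R) (hx : 0 < x < 1) (O A P Q U T : point)
    (hO : O = (0, 0)) (hA : A = (1, 0)) (hP : P = (x, y x))
    (hQ : line_through O P Q /\ vertical_line 1 Q)
    (hU : tangent_line y x U /\ vertical_line 0 U)
    (hT : tangent_line y x T /\ vertical_line 1 T) :
  A <> T /\
  exists c1 c2 : circle,
    unique (circle_through_tangent O (line_through U T) P) c1 /\
    unique (circle_through_tangent O (line_through A T) Q) c2 /\
    radius c1 = radius c2.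
Proof.
subst O A P.
destruct Q as [q1 q2], U as [u1 u2], T as [t1 t2].
unfold line_through, vertical_line, tangent_line in *; cbn [fst snd] in *.
destruct hQ as [hQ ->], hU as [hU ->], hT as [hT ->].
assert (Hode := interception_curve_ode y x hy hx).
assert (Hy : 0 < y x).
{ assert (H := interception_ray_slope_pos y x hy hx); unfold ray_slope in H.
  apply Rdiv_pos_cases in H; lra. }
assert (Hs := speed_ge_1 y x); unfold speed in Hs.
revert Hode Hs hU hT.
set (p := Derive y x); set (s := sqrt (1 + p ^ 2)); intros Hode Hs hU hT.
assert (Hx2 : 0 < x ^ 2) by (apply pow_lt; lra).
assert (Hp : 0 < x * p - y x) by (rewrite <- Hode; apply Rmult_lt_0_compat; lra).
assert (Ht2 : 0 < t2) by nra.
assert (Hq2 : q2 = y x / x) by (apply Rmult_eq_reg_r with x; [field_simplify|]; lra).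
split; [intros H; injection H; lra|].
destruct (circle_through_tangent_radius (0, u2) (1, t2) (x, y x) (0, 0))
  as [c1 [Hc1 Hr1]]; [unfold line_through; cbn; nra|cbn; nra|].
destruct (circle_through_tangent_radius (1, 0) (1, t2) (1, q2) (0, 0))
  as [c2 [Hc2 Hr2]]; [unfold line_through; cbn; nra|cbn; nra|].
exists c1, c2; split; [exact Hc1|split; [exact Hc2|]].
rewrite Hr1, Hr2, !dist_pt_sqr; cbn [fst snd].
replace (dist_pt (0, u2) (1, t2)) with s
  by (unfold s, dist_pt, dist_euc; cbn [fst snd]; f_equal; unfold Rsqr; nra).
replace (dist_pt (1, 0) (1, t2)) with t2
  by (unfold dist_pt, dist_euc; cbn [fst snd];
      rewrite Rminus_diag, Rsqr_0, Rplus_0_l, Rminus_0_l, <- Rsqr_neg;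
      rewrite sqrt_Rsqr; lra).
replace ((1 - 0) * (0 - u2) - (t2 - u2) * (0 - 0)) with (x ^ 2 * s) by nra.
replace ((1 - 1) * (0 - 0) - (t2 - 0) * (0 - 1)) with t2 by ring.
rewrite !Rabs_pos_eq; [|lra|apply Rmult_le_pos; lra].
rewrite Hq2; field; lra.
Qed.
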